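(* Assume $E\setminus T\ne\emptyset$, and let $\epsilon>0$, $0<p<1$, $K=\lceil\tau\ln\frac{n}{\epsilon p}\rceil$. Let $e_1,\dots,e_K$ be drawn independently from $(p_e)_{e\in E\setminus T}$, and let $F_K=\Pi_{e_K}\cdots\Pi_{e_1}R^{-1}B_TL_T^\dagger$ and $V_K=L_T^\dagger B_T^TF_K$. Then with probability at least $1-p$, \[ (F_K-R^{-1}BL^\dagger)^TR(F_K-R^{-1}BL^\dagger)\preceq\epsilon L_T^\dagger\preceq\epsilon\,\mathrm{st}(T)\,L^\dagger \] and \[ (V_K-L^\dagger)^TL(V_K-L^\dagger)\preceq\epsilon\,\mathrm{st}(T)^2L^\dagger . \]
   Context: Let $G=(V,E,w)$ be a connected undirected graph with $n=|V|$, resistances $r_e=1/w_e>0$ and fixed edge orientations $(a,b)$. The incidence matrix $B\in\mathbb{R}^{E\times V}$ has $B_{(a,b),c}=1$ if $c=a$, $-1$ if $c=b$, $0$ otherwise; $R=\mathrm{diag}(r_e)_{e\in E}$; $L=B^TR^{-1}B$ with pseudoinverse $L^\dagger$; $\preceq$ is the Loewner order. Let $T\subseteq E$ be a spanning tree; $B_T\in\mathbb{R}^{E\times V}$ equals $B$ on rows indexed by $T$ and is zero on rows indexed by $E\setminus T$; $L_T=B_T^TR^{-1}B_T$ with pseudoinverse $L_T^\dagger$. For vertices $a,b$, $\pi_{(a,b)}\in\mathbb{R}^E$ is the unit flow from $a$ to $b$ along the unique tree path, and $P_{(a,b)}$ its edge set. For $e=(a,b)\in E\setminus T$, $c_e=\mathbf{1}_e-\pi_{(a,b)}$,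 $R_e=c_e^TRc_e$, $\Pi_e=I-\frac{c_ec_e^TR}{c_e^TRc_e}$; $\tau=\sum_{e\in E\setminus T}R_e/r_e$; $p_e=\frac{R_e}{r_e\tau}$. The stretch of $e=(a,b)\in E$ is $\mathrm{st}(e)=\frac1{r_e}\sum_{e'\in P_{(a,b)}}r_{e'}$ and $\mathrm{st}(T)=\sum_{e\in E}\mathrm{st}(e)$. *)

(* Defs.v *)
From HB Require Import structures.
From Stdlib Require Import Reals ClassicalEpsilon FunctionalExtensionality.
From mathcomp Require Import all_boot all_order all_algebra.
Set Implicit Arguments. Unset Strict Implicit. Unset Printing Implicit Defensive.

Definition Req_bool (x y : R) : bool := if Req_EM_T x y then true else false.
Lemma Req_boolP : Equality.axiom Req_bool.
Proof. by move=> x y; rewrite /Req_bool; case: Req_EM_T => h; constructor. Qed.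
HB.instance Definition _ := hasDecEq.Build R Req_boolP.

Definition R_find (P : pred R) (_ : nat) : option R :=
  match excluded_middle_informative (exists x, P x) with
  | left h => Some (proj1_sig (constructive_indefinite_description _ h))
  | right _ => None end.
Lemma R_find_correct P n x : R_find P n = Some x -> P x.
Proof. rewrite /R_find; case: excluded_middle_informative => // h [<-].
exact: proj2_sig (constructive_indefinite_description _ h). Qed.
Lemma R_find_complete (P : pred R) : (exists x, P x) -> exists n, R_find P n.
Proof. move=> h; exists 0%N; rewrite /R_find; case: excluded_middle_informative => //. Qed.
Lemma R_find_ext (P Q : pred R) : P =1 Q -> R_find P =1 R_find Q.
Proof. by move=> /functional_extensionality ->. Qed.
HB.instance Definition _ := hasChoice.Build R R_find_correct R_find_complete R_find_ext.

Lemma R_addA : associative Rplus. Proof. by move=> x y z; rewrite Rplus_assoc. Qed.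
Lemma R_addC : commutative Rplus. Proof. exact: Rplus_comm. Qed.
Lemma R_add0 : left_id R0 Rplus. Proof. exact: Rplus_0_l. Qed.
Lemma R_addN : left_inverse R0 Ropp Rplus. Proof. exact: Rplus_opp_l. Qed.
HB.instance Definition _ := GRing.isZmodule.Build R R_addA R_addC R_add0 R_addN.

Lemma R_mulA : associative Rmult. Proof. by move=> x y z; rewrite Rmult_assoc. Qed.
Lemma R_mulC : commutative Rmult. Proof. exact: Rmult_comm. Qed.
Lemma R_mul1 : left_id R1 Rmult. Proof. exact: Rmult_1_l. Qed.
Lemma R_mulDl : left_distributive Rmult Rplus. Proof. by move=> x y z; rewrite Rmult_plus_distr_r. Qed.
Lemma R_one_neq0 : R1 != R0. Proof. by apply/eqP; exact: R1_neq_R0. Qed.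
HB.instance Definition _ := GRing.Zmodule_isComNzRing.Build R R_mulA R_mulC R_mul1 R_mulDl R_one_neq0.


Import GRing.Theory.
Local Open Scope ring_scope.

(* ---------- Graph data ----------
   Vertices: 'I_n.  Edges: 'I_m; edge e is oriented (src e, dst e).
   Resistances r : 'I_m -> R, all positive.                           *)

Definition adj (n m : nat) (src dst : 'I_m -> 'I_n) (S : {set 'I_m}) : rel 'I_n :=
  fun u v => [exists e in S,
     ((src e == u) && (dst e == v)) || ((src e == v) && (dst e == u))].

Definition connected_edges (n m : nat) (src dst : 'I_m -> 'I_n) (S : {set 'I_m}) : Prop :=
  forall u v : 'I_n, connect (adj src dst S) u v.

(* T is a spanning tree: (V,T) is connected and acyclic
   (acyclic = every edge of T is a bridge of (V,T)) *)
Definition spanning_tree (n m : nat) (src dst : 'I_m -> 'I_n) (T : {set 'I_m}) : Prop :=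
  connected_edges src dst T /\
  forall e, e \in T -> ~~ connect (adj src dst (T :\ e)) (src e) (dst e).

Definition incidence (n m : nat) (src dst : 'I_m -> 'I_n) : 'M[R]_(m, n) :=
  \matrix_(e < m, c < n)
    (if c == src e then 1 else if c == dst e then -1 else 0).

Definition incidence_on (n m : nat) (src dst : 'I_m -> 'I_n) (T : {set 'I_m}) : 'M[R]_(m, n) :=
  \matrix_(e < m, c < n) (if e \in T then incidence src dst e c else 0).

Definition resmx (m : nat) (r : 'I_m -> R) : 'M[R]_m := diag_mx (\row_e r e).
Definition invresmx (m : nat) (r : 'I_m -> R) : 'M[R]_m := diag_mx (\row_e Rinv (r e)).

Definition laplacian (n m : nat) (src dst : 'I_m -> 'I_n) (r : 'I_m -> R) : 'M[R]_n :=
  (incidence src dst)^T *m invresmx r *m incidence src dst.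
Definition tree_laplacian (n m : nat) (src dst : 'I_m -> 'I_n) (r : 'I_m -> R)
  (T : {set 'I_m}) : 'M[R]_n :=
  (incidence_on src dst T)^T *m invresmx r *m incidence_on src dst T.

(* Moore-Penrose pseudoinverse: the unique X with the four Penrose identities *)
Definition is_pinv (k l : nat) (A : 'M[R]_(k, l)) (X : 'M[R]_(l, k)) : Prop :=
  [/\ A *m X *m A = A, X *m A *m X = X, (A *m X)^T = A *m X & (X *m A)^T = X *m A].
Definition pinv (k l : nat) (A : 'M[R]_(k, l)) : 'M[R]_(l, k) :=
  epsilon (inhabits 0) (is_pinv A).

Definition unitv (k : nat) (i : 'I_k) : 'cV[R]_k := delta_mx i ord0.

(* pi_(a,b): the unit flow from a to b along the tree path, i.e. the unique
   edge vector supported on T with B^T pi = 1_a - 1_b *)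
Definition is_tree_flow (n m : nat) (src dst : 'I_m -> 'I_n) (T : {set 'I_m})
  (a b : 'I_n) (f : 'cV[R]_m) : Prop :=
  (forall e, e \notin T -> f e ord0 = 0) /\
  (incidence src dst)^T *m f = unitv a - unitv b.
Definition tree_flow (n m : nat) (src dst : 'I_m -> 'I_n) (T : {set 'I_m})
  (a b : 'I_n) : 'cV[R]_m :=
  epsilon (inhabits 0) (is_tree_flow src dst T a b).

Definition tree_path (n m : nat) (src dst : 'I_m -> 'I_n) (T : {set 'I_m})
  (a b : 'I_n) : {set 'I_m} :=
  [set e | tree_flow src dst T a b e ord0 != 0].

Definition cycvec (n m : nat) (src dst : 'I_m -> 'I_n) (T : {set 'I_m}) (e : 'I_m)
  : 'cV[R]_m := unitv e - tree_flow src dst T (src e) (dst e).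

Definition cycres (n m : nat) (src dst : 'I_m -> 'I_n) (r : 'I_m -> R)
  (T : {set 'I_m}) (e : 'I_m) : R :=
  ((cycvec src dst T e)^T *m resmx r *m cycvec src dst T e) ord0 ord0.

Definition projmx (n m : nat) (src dst : 'I_m -> 'I_n) (r : 'I_m -> R)
  (T : {set 'I_m}) (e : 'I_m) : 'M[R]_m :=
  1%:M - Rinv (cycres src dst r T e) *:
         (cycvec src dst T e *m (cycvec src dst T e)^T *m resmx r).

Definition tau (n m : nat) (src dst : 'I_m -> 'I_n) (r : 'I_m -> R) (T : {set 'I_m}) : R :=
  \sum_(e < m | e \notin T) Rdiv (cycres src dst r T e) (r e).

Definition sprob (n m : nat) (src dst : 'I_m -> 'I_n) (r : 'I_m -> R)
  (T : {set 'I_m}) (e : 'I_m) : R :=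
  if e \in T then 0 else Rdiv (cycres src dst r T e) (r e * tau src dst r T).

Definition stretch (n m : nat) (src dst : 'I_m -> 'I_n) (r : 'I_m -> R)
  (T : {set 'I_m}) (e : 'I_m) : R :=
  Rinv (r e) * \sum_(e' in tree_path src dst T (src e) (dst e)) r e'.
Definition stretchT (n m : nat) (src dst : 'I_m -> 'I_n) (r : 'I_m -> R)
  (T : {set 'I_m}) : R := \sum_(e < m) stretch src dst r T e.

Definition projprod (n m : nat) (src dst : 'I_m -> 'I_n) (r : 'I_m -> R)
  (T : {set 'I_m}) (s : seq 'I_m) : 'M[R]_m :=
  foldl (fun acc e => projmx src dst r T e *m acc) 1%:M s.

Definition FK (n m : nat) (src dst : 'I_m -> 'I_n) (r : 'I_m -> R)
  (T : {set 'I_m}) (s : seq 'I_m) : 'M[R]_(m, n) :=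
  projprod src dst r T s *m invresmx r *m incidence_on src dst T
    *m pinv (tree_laplacian src dst r T).

Definition VK (n m : nat) (src dst : 'I_m -> 'I_n) (r : 'I_m -> R)
  (T : {set 'I_m}) (s : seq 'I_m) : 'M[R]_n :=
  pinv (tree_laplacian src dst r T) *m (incidence_on src dst T)^T *m FK src dst r T s.

Definition loewner_le (k : nat) (A B : 'M[R]_k) : Prop :=
  forall x : 'cV[R]_k, Rle ((x^T *m A *m x) ord0 ord0) ((x^T *m B *m x) ord0 ord0).

Definition Rceil (x : R) : Z :=
  if Req_EM_T (Rminus (IZR (up x)) R1) x then Z.pred (up x) else up x.

Definition indic (P : Prop) : R :=
  if excluded_middle_informative P then R1 else R0.
Definition prob_iid (m K : nat) (q : 'I_m -> R) (ev : K.-tuple 'I_m -> Prop) : R :=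
  \sum_(s : K.-tuple 'I_m) (\prod_(e <- s) q e) * indic (ev s).

(* Main.v *)
(** For [G : R^E x V] put [phi(G) = tr (L_T G^T R G)].  The initial error
    [D_0 = R^{-1} B_T L_T^+ - R^{-1} B L^+] has its columns in the cycle space, each [Pi_e]
    fixes the optimal flow [R^{-1} B L^+], and hence the error after [K] steps is
    [D = Pi_{e_K} ... Pi_{e_1} D_0].  Every cycle vector [g] is the combination of the
    fundamental cycles [c_e] with coefficients [g_e], so Cauchy-Schwarz gives
    [g^T R g <= sum_e (c_e^T R g)^2 / r_e]; this makes one random projection contract the
    expected energy, and so [phi], by the factor [1 - 1/tau].  Since [D_0^T R D_0 = L_T^+ - L^+],
    [phi(D_0) <= tr (L_T L_T^+) <= n], and Markov's inequality yields [phi(D) <= eps] with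
    probability at least [1 - p].  A Frobenius norm estimate turns this into
    [D^T R D <= eps L_T^+].  The remaining inequalities are deterministic and follow from
    [L <= st(T) L_T] and [ker L = ker L_T], where the stretch enters because the tree flow
    across an edge is a difference of two values of the indicator of one side of a
    fundamental cut. *)
Require Import Defs.
From HB Require Import structures.
From Stdlib Require Import Reals.
From Stdlib Require Import Lia ClassicalEpsilon.
From mathcomp Require Import all_boot all_order all_algebra.
From mathcomp Require Import ring lra.
Import Order.TTheory GRing.Theory Num.Theory.
Local Open Scope ring_scope.

Set Implicit Arguments. Unset Strict Implicit. Unset Printing Implicit Defensive.

(** * Quadratic forms and pseudoinverses *)

Section QuadraticForms.
Variable F : realFieldType.
Implicit Types k l : nat.

(** [A * (A * C - S ^+ 2)] is a weighted sum of squares, which settles [A > 0]. If [A = 0], every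
    [w i * a i ^+ 2] vanishes, and hence so does [S]. *)
Lemma Cauchy_Schwarz_sum (I : finType) (w a b : I -> F) :
  (forall i, 0 <= w i) ->
  (\sum_i w i * a i * b i) ^+ 2 <=
    (\sum_i w i * a i ^+ 2) * (\sum_i w i * b i ^+ 2).
Proof.
move=> w0; set A := \sum_i w i * a i ^+ 2; set C := \sum_i w i * b i ^+ 2.
set S := \sum_i _.
have A0 : 0 <= A by apply: sumr_ge0 => i _; rewrite mulr_ge0 ?sqr_ge0.
have key : 0 <= A * (A * C - S ^+ 2).
  have -> : A * (A * C - S ^+ 2) = \sum_i w i * (S * a i - A * b i) ^+ 2.
    transitivity (\sum_i (S ^+ 2 * (w i * a i ^+ 2) +
        (- (2 * S * A)) * (w i * a i * b i) + A ^+ 2 * (w i * b i ^+ 2))).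
      by rewrite !big_split /= -!mulr_sumr -/A -/C -/S; ring.
    by apply: eq_bigr => i _; ring.
  by apply: sumr_ge0 => i _; rewrite mulr_ge0 ?sqr_ge0.
have [Az|Anz] := eqVneq A 0; last first.
  by rewrite -subr_ge0 -(pmulr_rge0 _ (_ : 0 < A)) // lt_def Anz.
have wa i : w i * a i ^+ 2 = 0.
  have := psumr_eq0P (P := predT) (F := fun i => w i * a i ^+ 2)
    (fun i _ => mulr_ge0 (w0 i) (sqr_ge0 _)) Az.
  exact.
rewrite Az mul0r (_ : S = 0) ?expr0n //.
apply: big1 => i _; have /eqP := wa i.
by rewrite mulf_eq0 sqrf_eq0 => /orP[] /eqP ->; rewrite ?mulr0 !mul0r.
Qed.

Definition bform k (A : 'M[F]_k) (x y : 'cV[F]_k) : F := (x^T *m A *m y) ord0 ord0.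

Lemma bform_diag k (d : 'rV[F]_k) (x y : 'cV[F]_k) :
  bform (diag_mx d) x y = \sum_i d ord0 i * x i ord0 * y i ord0.
Proof.
rewrite /bform mxE; apply: eq_bigr => i _.
by rewrite mul_mx_diag !mxE [_ * d _ _]mulrC.
Qed.

Lemma bform_congr k l (A : 'M[F]_k) (M : 'M[F]_(k, l)) x y :
  bform (M^T *m A *m M) x y = bform A (M *m x) (M *m y).
Proof. by rewrite /bform trmx_mul !mulmxA. Qed.

Lemma bform_diag_ge0 k (d : 'rV[F]_k) (x : 'cV[F]_k) :
  (forall i, 0 <= d ord0 i) -> 0 <= bform (diag_mx d) x x.
Proof.
move=> d0; rewrite bform_diag; apply: sumr_ge0 => i _.
by rewrite -mulrA mulr_ge0 // -expr2 sqr_ge0.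
Qed.

Lemma Cauchy_Schwarz_diag k (d : 'rV[F]_k) (x y : 'cV[F]_k) :
  (forall i, 0 <= d ord0 i) ->
  bform (diag_mx d) x y ^+ 2 <= bform (diag_mx d) x x * bform (diag_mx d) y y.
Proof.
move=> d0; rewrite !bform_diag.
apply: le_trans (Cauchy_Schwarz_sum _ _ d0) _.
by under eq_bigr do rewrite expr2 mulrA; under [X in _ * X]eq_bigr do rewrite expr2 mulrA.
Qed.

(* Cancels one factor in an inequality produced by Cauchy-Schwarz. *)
Lemma le_of_sqr_le_mul (a b : F) : 0 <= a -> 0 <= b -> a ^+ 2 <= b * a -> a <= b.
Proof.
move=> a0 b0; rewrite expr2; have [->|an0] := eqVneq a 0; first by [].
by rewrite ler_pM2r // lt_def an0.
Qed.

Lemma bform_diag_eq0 k (d : 'rV[F]_k) (x : 'cV[F]_k) :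
  (forall i, 0 < d ord0 i) -> bform (diag_mx d) x x = 0 -> x = 0.
Proof.
move=> d0; rewrite bform_diag => h; apply/matrixP => i j; rewrite (ord1 j) [RHS]mxE.
have nn q : predT q -> 0 <= d ord0 q * x q ord0 * x q ord0.
  by move=> _; rewrite -mulrA -expr2 mulr_ge0 ?sqr_ge0 ?ltW.
have /eqP := psumr_eq0P nn h (isT : predT i).
by rewrite -mulrA mulf_eq0 gt_eqF //= -expr2 sqrf_eq0 => /eqP.
Qed.

(** If [u *m A *m A^T = 0], then the squared Euclidean norm of [u *m A] is zero, so [u *m A = 0] and
    [u = 0]. *)
Lemma gram_row_free k l (A : 'M[F]_(k, l)) : row_free A -> A *m A^T \in unitmx.
Proof.
move=> Af; rewrite -row_free_unit -kermx_eq0; apply/eqP/row_matrixP => i.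
rewrite row0; set u := row i _.
have uA : u *m (A *m A^T) = 0 by apply/sub_kermxP; exact: row_sub.
suff : u *m A = 0 by move=> h; apply: (row_free_inj Af); rewrite mul0mx.
have := @bform_diag_eq0 l (const_mx 1) (u *m A)^T.
rewrite /bform diag_const_mx mulmx1 trmxK trmx_mul !mulmxA -(mulmxA u) uA mul0mx mxE.
move=> h; apply: trmx_inj; rewrite trmx_mul trmx0; apply: h => // j.
by rewrite mxE.
Qed.

(** The classical formula from a full-rank factorisation: both Gram matrices are invertible,
    [A *m X] collapses to [C *m V *m C^T] and [X *m A] to [D^T *m U *m D], which are visibly
    symmetric. *)
Lemma full_rank_moore_penrose k q l (C : 'M[F]_(k, q)) (D : 'M[F]_(q, l)) :
  row_full C -> row_free D ->
  let A := C *m D in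
  let X := D^T *m invmx (D *m D^T) *m invmx (C^T *m C) *m C^T in
  [/\ A *m X *m A = A, X *m A *m X = X, (A *m X)^T = A *m X & (X *m A)^T = X *m A].
Proof.
move=> Cf Df A X; rewrite {}/A.
have Du : D *m D^T \in unitmx by exact: gram_row_free.
have Cu : C^T *m C \in unitmx.
  have := @gram_row_free _ _ C^T; rewrite trmxK; apply.
  by rewrite /row_free mxrank_tr.
rewrite {}/X; set U := invmx (D *m D^T); set V := invmx _.
have AX : C *m D *m (D^T *m U *m V *m C^T) = C *m V *m C^T.
  by rewrite !mulmxA -(mulmxA C D) -(mulmxA C _ U) mulmxV // mulmx1.
have XA : D^T *m U *m V *m C^T *m (C *m D) = D^T *m U *m D.
  by rewrite !mulmxA -(mulmxA _ C^T C) -(mulmxA _ V) mulVmx // mulmx1.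
have Us : U^T = U by rewrite trmx_inv trmx_mul trmxK.
have Vs : V^T = V by rewrite trmx_inv trmx_mul trmxK.
split.
- by rewrite AX !mulmxA -(mulmxA _ C^T C) -(mulmxA _ V) mulVmx // mulmx1.
- rewrite XA !mulmxA -(mulmxA _ D D^T) -(mulmxA _ U (D *m _)) mulVmx //.
  by rewrite mulmx1.
- by rewrite AX !trmx_mul trmxK Vs mulmxA.
- by rewrite XA !trmx_mul trmxK Us mulmxA.
Qed.

Lemma moore_penrose_exists k l (A : 'M[F]_(k, l)) : exists X : 'M[F]_(l, k),
  [/\ A *m X *m A = A, X *m A *m X = X, (A *m X)^T = A *m X & (X *m A)^T = X *m A].
Proof.
have := full_rank_moore_penrose (col_base_full A) (row_base_free A).
by rewrite /= mulmx_base => h; eexists; exact: h.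
Qed.

End QuadraticForms.

(** * The real numbers as an ordered field *)

Lemma R_mulVx (x : R) : x != 0 -> Rinv x * x = 1.
Proof. by move/eqP => x0; exact: Rinv_l. Qed.

HB.instance Definition _ := GRing.ComNzRing_isField.Build R R_mulVx Rinv_0.

Definition Rle_bool (x y : R) : bool := if Rle_dec x y then true else false.
Definition Rlt_bool (x y : R) : bool := if Rlt_dec x y then true else false.

Lemma Rle_boolP x y : reflect (Rle x y) (Rle_bool x y).
Proof. by rewrite /Rle_bool; case: Rle_dec => h; constructor. Qed.

Lemma Rlt_boolP x y : reflect (Rlt x y) (Rlt_bool x y).
Proof. by rewrite /Rlt_bool; case: Rlt_dec => h; constructor. Qed.

Section ROrder.
Implicit Types x y : R.

Fact R_le0_add x y : Rle_bool 0 x -> Rle_bool 0 y -> Rle_bool 0 (x + y).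
Proof. by move=> /Rle_boolP hx /Rle_boolP hy; apply/Rle_boolP/Rplus_le_le_0_compat. Qed.

Fact R_le0_mul x y : Rle_bool 0 x -> Rle_bool 0 y -> Rle_bool 0 (x * y).
Proof. by move=> /Rle_boolP hx /Rle_boolP hy; apply/Rle_boolP/Rmult_le_pos. Qed.

Fact R_le0_anti x : Rle_bool 0 x -> Rle_bool x 0 -> x = 0.
Proof. by move=> /Rle_boolP hx /Rle_boolP hy; exact: Rle_antisym. Qed.

Fact R_sub_ge0 x y : Rle_bool 0 (y - x) = Rle_bool x y.
Proof.
apply/Rle_boolP/Rle_boolP => h.
  by apply: Rminus_le; have := Ropp_le_contravar _ _ h; rewrite Ropp_0 Ropp_minus_distr.
by apply: Rge_le; apply: Rge_minus; apply: Rle_ge.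
Qed.

Fact R_le0_total x : Rle_bool 0 x || Rle_bool x 0.
Proof. by case: (Rle_or_lt 0 x) => h; apply/orP; [left|right]; apply/Rle_boolP => //; left. Qed.

Fact R_ge0_norm x : Rle_bool 0 x -> Rabs x = x.
Proof. by move=> /Rle_boolP h; apply: Rabs_pos_eq. Qed.

Fact R_lt_def x y : Rlt_bool x y = (y != x) && Rle_bool x y.
Proof.
apply/Rlt_boolP/andP => [h|[/eqP yx /Rle_boolP []//]].
  by split; [apply/eqP; exact: Rgt_not_eq|apply/Rle_boolP; left].
by move/esym.
Qed.

End ROrder.

HB.instance Definition _ := Num.IntegralDomain_isLeReal.Build R
  R_le0_add R_le0_mul R_le0_anti R_sub_ge0 R_le0_total Rabs_Ropp R_ge0_norm R_lt_def.

Lemma RleP (x y : R) : reflect (Rle x y) (x <= y).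
Proof. exact: Rle_boolP. Qed.

Lemma RltP (x y : R) : reflect (Rlt x y) (x < y).
Proof. exact: Rlt_boolP. Qed.

(** * Uniqueness, symmetry and projections of pseudoinverses *)

Lemma pinvP k l (A : 'M[R]_(k, l)) : is_pinv A (pinv A).
Proof.
rewrite /pinv; apply: epsilon_spec.
exact: moore_penrose_exists.
Qed.

(** The symmetric idempotents [X *m A] and [Y *m A] absorb each other, so transposing shows them
    equal; the same holds for [A *m X] and [A *m Y]. *)
Lemma is_pinv_uniq k l (A : 'M[R]_(k, l)) X Y : is_pinv A X -> is_pinv A Y -> X = Y.
Proof.
move=> [X1 X2 X3 X4] [Y1 Y2 Y3 Y4].
have XY : X *m A = Y *m A.
  have h : X *m A *m (Y *m A) = X *m A by rewrite -mulmxA [A *m _]mulmxA Y1.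
  have h' : Y *m A *m (X *m A) = Y *m A by rewrite -mulmxA [A *m _]mulmxA X1.
  by rewrite -h -[LHS]trmxK trmx_mul X4 Y4 h'.
have YX : A *m X = A *m Y.
  have h : A *m X *m (A *m Y) = A *m Y by rewrite !mulmxA X1.
  have h' : A *m Y *m (A *m X) = A *m X by rewrite !mulmxA Y1.
  by rewrite -h -[RHS]trmxK trmx_mul X3 Y3 h'.
by rewrite -X2 XY -mulmxA YX mulmxA Y2.
Qed.

Lemma is_pinv_tr k (A X : 'M[R]_k) : A^T = A -> is_pinv A X -> is_pinv A X^T.
Proof.
move=> As [h1 h2 h3 h4].
have AX : A *m X^T = X *m A by rewrite -h4 trmx_mul As.
have XA : X^T *m A = A *m X by rewrite -h3 trmx_mul As.
split; rewrite ?AX ?XA //.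
  by have := congr1 trmx h1; rewrite -mulmxA trmx_mul h4 As.
by have := congr1 trmx h2; rewrite -mulmxA trmx_mul h3.
Qed.

Lemma pinv_sym k (A : 'M[R]_k) : A^T = A -> (pinv A)^T = pinv A.
Proof.
by move=> As; apply: (is_pinv_uniq (A := A)) (pinvP A); exact: is_pinv_tr (pinvP A).
Qed.

Lemma pinv_comm k (A : 'M[R]_k) : A^T = A -> A *m pinv A = pinv A *m A.
Proof.
by move=> As; have [_ _ h3 _] := pinvP A; rewrite -h3 trmx_mul (pinv_sym As) As.
Qed.

(** Both sides are the orthogonal projection onto the complement of the common kernel. *)
Lemma pinv_proj_eq k (A B : 'M[R]_k) : A^T = A -> B^T = B ->
  (forall x : 'cV_k, A *m x = 0 <-> B *m x = 0) ->
  pinv A *m A = pinv B *m B.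
Proof.
move=> As Bs h.
have [a1 a2 a3 a4] := pinvP A; have [b1 b2 b3 b4] := pinvP B.
have ker (M N : 'M[R]_k) : (forall x : 'cV_k, N *m x = 0 -> M *m x = 0) ->
  N *m pinv N *m N = N -> M *m (pinv N *m N) = M.
  move=> hx N1; apply/eqP; rewrite -subr_eq0 -[X in _ - X]mulmx1 -mulmxBr.
  apply/eqP/trmx_inj/row_matrixP => i.
  rewrite -tr_col trmx0 row0 -trmx0; congr (_^T).
  rewrite colE -mulmxA hx // mulmxA mulmxBr mulmx1 mulmxA N1 subrr.
  by rewrite mul0mx.
have hA : A *m (pinv B *m B) = A by apply: ker => // x; apply (proj2 (h x)).
have hB : B *m (pinv A *m A) = B by apply: ker => // x; apply (proj1 (h x)).
have PQ : pinv A *m A *m (pinv B *m B) = pinv A *m A by rewrite -mulmxA hA.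
have QP : pinv B *m B *m (pinv A *m A) = pinv B *m B by rewrite -mulmxA hB.
by rewrite -[LHS]PQ -[RHS]b4 -[in RHS]QP trmx_mul a4 b4.
Qed.

(** [Q] is a symmetric idempotent, so [Q i i] is the sum of the squares in row [i]; thus
    [Q i i ^+ 2 <= Q i i], and no diagonal entry exceeds 1. *)
Lemma trace_pinv_mul k (A : 'M[R]_k) : \tr (pinv A *m A) <= k%:R.
Proof.
have [a1 a2 a3 a4] := pinvP A; move: a4; set Q := _ *m A => Qs.
have QQ : Q *m Q = Q by rewrite /Q mulmxA a2.
clearbody Q.
rewrite -[k in k%:R]card_ord -sum1_card natr_sum; apply: ler_sum => i _.
have Qi : Q i i = \sum_j Q i j ^+ 2.
  rewrite -{1}QQ mxE; apply: eq_bigr => j _.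
  by rewrite -{2}Qs mxE expr2.
have : Q i i ^+ 2 <= Q i i.
  rewrite {2}Qi (bigD1 i) //= lerDl; apply: sumr_ge0 => j _; exact: sqr_ge0.
nra.
Qed.

(** * Sums over tuples *)

Lemma sum_tuple0 (V : nmodType) (I : finType) (f : 0.-tuple I -> V) :
  \sum_s f s = f [tuple].
Proof. by apply: big_pred1 => s; apply/esym/eqP; rewrite [s]tuple0. Qed.

Lemma sum_tuple_cons (V : nmodType) (I : finType) K (f : K.+1.-tuple I -> V) :
  \sum_s f s = \sum_i \sum_(s : K.-tuple I) f [tuple of i :: s].
Proof.
rewrite pair_big (reindex (fun u : I * K.-tuple I => [tuple of u.1 :: u.2])) //=.
exists (fun s : K.+1.-tuple I => (thead s, [tuple of behead s])) => [[i s] _|s _] /=.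
  by congr (_, _); apply: val_inj.
by rewrite [RHS]tuple_eta; apply: val_inj.
Qed.

Lemma sum_prod_tuple (S : comPzSemiRingType) (I : finType) K (q : I -> S) :
  \sum_(s : K.-tuple I) \prod_(i <- s) q i = (\sum_i q i) ^+ K.
Proof.
elim: K => [|K IH].
  by rewrite sum_tuple0 big_nil expr0.
rewrite sum_tuple_cons exprS mulr_suml; apply: eq_bigr => i _.
by rewrite -IH mulr_sumr; apply: eq_bigr => s _; rewrite big_cons.
Qed.

(** * Tree flows, cycle space and random projections *)

Lemma RdivE (x y : R) : Rdiv x y = x / y.
Proof. by []. Qed.

Section SpanningTree.
Variables (n m : nat) (src dst : 'I_m -> 'I_n) (r : 'I_m -> R) (T : {set 'I_m}).
Hypothesis src_neq_dst : forall e, src e != dst e.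
Hypothesis r_gt0 : forall e, 0 < r e.
Hypothesis treeT : spanning_tree src dst T.

Local Notation B := (incidence src dst).
Local Notation BT := (incidence_on src dst T).
Local Notation W := (invresmx r).
Local Notation Rm := (resmx r).
Local Notation L := (laplacian src dst r).
Local Notation LT := (tree_laplacian src dst r T).
Local Notation flow := (tree_flow src dst T).
Local Notation cyc := (cycvec src dst T).
Local Notation res := (cycres src dst r T).

Lemma incidence_mulE (x : 'cV[R]_n) e :
  (B *m x) e ord0 = x (src e) ord0 - x (dst e) ord0.
Proof.
have sd : dst e != src e by rewrite eq_sym.
rewrite mxE (bigD1 (src e)) //= (bigD1 (dst e)) //= !mxE eqxx (negbTE sd) eqxx.
rewrite big1 ?addr0 ?mul1r ?mulN1r // => v /andP[/negbTE v1 /negbTE v2].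
by rewrite mxE v1 v2 mul0r.
Qed.

Lemma incidence_on_mulE (x : 'cV[R]_n) e :
  (BT *m x) e ord0 = if e \in T then (B *m x) e ord0 else 0.
Proof.
rewrite !mxE; case: ifPn => eT.
  by apply: eq_bigr => v _; rewrite [in LHS]mxE eT.
by apply: big1 => v _; rewrite mxE (negbTE eT) mul0r.
Qed.

Lemma incidence_tr_unitv e : B^T *m unitv e = unitv (src e) - unitv (dst e).
Proof.
apply/matrixP => v j; rewrite (ord1 j) -colE !mxE !eqxx !andbT.
have := src_neq_dst e; case: (eqVneq v (src e)) => [->|_].
  by move/negbTE => ->; rewrite subr0.
by move=> _; case: eqP => _; rewrite sub0r ?oppr0.
Qed.

(* Removing the tree edge [e] splits the tree in two sides; this is the
   indicator vector of the side of [src e]. *)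
Definition cut_vector (e : 'I_m) : 'cV[R]_n :=
  \col_v (connect (adj src dst (T :\ e)) (src e) v)%:R.

(** Another tree edge survives the removal of [e], so its ends lie on the same side; [e] itself is a
    bridge, so its ends are separated. *)
Lemma cut_vectorE e e' : e \in T -> e' \in T ->
  (B *m cut_vector e) e' ord0 = (e' == e)%:R.
Proof.
move=> eT e'T; rewrite incidence_mulE !mxE.
have [->|ne] := eqVneq e' e.
  by rewrite connect0 (negbTE (proj2 treeT e eT)) subr0.
suff -> : connect (adj src dst (T :\ e)) (src e) (src e') =
          connect (adj src dst (T :\ e)) (src e) (dst e') by rewrite subrr.
have a1 : adj src dst (T :\ e) (src e') (dst e').
  by apply/existsP; exists e'; rewrite !inE ne e'T !eqxx.
have a2 : adj src dst (T :\ e) (dst e') (src e').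
  by apply/existsP; exists e'; rewrite !inE ne e'T !eqxx orbT.
apply/idP/idP => h; apply: connect_trans h _; exact: connect1.
Qed.

(** The right-hand side is the net flow out of the side of [src e], and [e] is the only tree edge
    that crosses the cut. *)
Lemma flow_through_tree_edge (f : 'cV[R]_m) e :
  (forall e', e' \notin T -> f e' ord0 = 0) -> e \in T ->
  f e ord0 = ((cut_vector e)^T *m (B^T *m f)) ord0 ord0.
Proof.
move=> fT eT; rewrite mulmxA -trmx_mul mxE (bigD1 e) //= big1 => [|e' ne].
  by rewrite mxE cut_vectorE // eqxx mul1r addr0.
have [e'T|/fT ->] := boolP (e' \in T); last by rewrite mulr0.
by rewrite mxE cut_vectorE // (negbTE ne) mul0r.
Qed.

Lemma tree_circulation_eq0 (f : 'cV[R]_m) :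
  (forall e, e \notin T -> f e ord0 = 0) -> B^T *m f = 0 -> f = 0.
Proof.
move=> fT Bf; apply/matrixP => e j; rewrite (ord1 j) [RHS]mxE.
have [eT|/fT//] := boolP (e \in T).
by rewrite flow_through_tree_edge // Bf mulmx0 mxE.
Qed.

Lemma tree_flow_exists a b : exists f, is_tree_flow src dst T a b f.
Proof.
have /connectP[q + ->] := proj1 treeT a b.
elim: q a => [|c q IH] a /=.
  by move=> _; exists 0; split => [e _|]; rewrite ?mxE // mulmx0 subrr.
case/andP => /existsP[e /andP[eT ac]] /IH[f [fT fB]].
(* [s] is the sign that corrects for an edge traversed against its orientation. *)
have [s sP] : exists s : R, s *: (unitv (src e) - unitv (dst e)) =
    unitv a - unitv c :> 'cV[R]_n.
  case/orP: ac => /andP[/eqP <- /eqP <-]; first by exists 1; rewrite scale1r.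
  by exists (-1); rewrite scaleN1r opprB.
exists (s *: unitv e + f); split => [e' e'T|].
  rewrite !mxE fT // addr0; case: eqP => [ee|_]; last by rewrite mulr0.
  by rewrite ee eT in e'T.
by rewrite mulmxDr -scalemxAr incidence_tr_unitv sP fB addrA subrK.
Qed.

Lemma tree_flowP a b : is_tree_flow src dst T a b (flow a b).
Proof. by rewrite /tree_flow; apply: epsilon_spec; exact: tree_flow_exists. Qed.

Lemma tree_flow_sqr_le1 a b e : flow a b e ord0 ^+ 2 <= 1.
Proof.
have [fT fB] := tree_flowP a b.
have [eT|/fT ->] := boolP (e \in T); last by rewrite expr0n ler01.
rewrite flow_through_tree_edge // fB mulmxBr -!colE !mxE.
by do 2 case: (connect _ _ _); rewrite /=; lra.
Qed.

Lemma incidence_tr_cycvec e : B^T *m cyc e = 0.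
Proof.
by rewrite mulmxBr (proj2 (tree_flowP _ _)) incidence_tr_unitv subrr.
Qed.

Lemma cycvec_off_tree e e' : e' \notin T -> cyc e e' ord0 = (e' == e)%:R.
Proof.
by move=> eT; rewrite !mxE (proj1 (tree_flowP _ _)) // subr0 eqxx andbT.
Qed.

(** Off the tree, [cyc e] is the indicator of [e], so the difference of the two sides is a
    circulation supported on the tree, hence zero. *)
Lemma cycle_space_decomposition (g : 'cV[R]_m) : B^T *m g = 0 ->
  g = \sum_(e | e \notin T) g e ord0 *: cyc e.
Proof.
move=> Bg; apply/eqP; rewrite -subr_eq0; apply/eqP; apply: tree_circulation_eq0.
  move=> e eT; rewrite mxE [in X in _ + X]mxE summxE (bigD1 e) //= big1.
    by rewrite addr0 mxE cycvec_off_tree // eqxx mulr1 subrr.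
  move=> e' /andP[_ ne]; rewrite mxE cycvec_off_tree // eq_sym (negbTE ne).
  by rewrite mulr0.
rewrite mulmxBr Bg sub0r mulmx_sumr big1 ?oppr0 // => e _.
by rewrite -scalemxAr incidence_tr_cycvec scaler0.
Qed.

(** * Energy forms and the stretch bound *)

Lemma bform_resE (x y : 'cV[R]_m) :
  bform Rm x y = \sum_e r e * x e ord0 * y e ord0.
Proof. by rewrite /resmx bform_diag; apply: eq_bigr => e _; rewrite mxE. Qed.

Lemma bform_invresE (x y : 'cV[R]_m) :
  bform W x y = \sum_e (r e)^-1 * x e ord0 * y e ord0.
Proof. by rewrite /invresmx bform_diag; apply: eq_bigr => e _; rewrite mxE. Qed.

Lemma invresmx_mulE k (M : 'M[R]_(m, k)) e j : (W *m M) e j = (r e)^-1 * M e j.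
Proof. by rewrite mul_diag_mx !mxE. Qed.

Lemma invresmxK : Rm *m W = 1%:M.
Proof.
apply/matrixP => e e'; rewrite mul_diag_mx !mxE.
by case: eqP => [->|_]; rewrite ?mulr0 // mulr1n mulfV // gt_eqF.
Qed.

Lemma res_ge0 (e : 'I_m) : 0 <= (\row_e r e) ord0 e.
Proof. by rewrite mxE ltW. Qed.

Lemma invres_gt0 (e : 'I_m) : 0 < (\row_e Rinv (r e)) ord0 e.
Proof. by rewrite mxE; have := r_gt0 e; rewrite -invr_gt0. Qed.

Lemma bform_res_invresmx (x : 'cV[R]_m) : bform Rm (W *m x) (W *m x) = bform W x x.
Proof.
rewrite bform_invresE bform_resE; apply: eq_bigr => e _.
by rewrite invresmx_mulE; field; rewrite gt_eqF.
Qed.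

(** The coordinate of [cyc e] at [e] is 1 and contributes [r e] alone. In particular the
    denominators [res e] are positive. *)
Lemma res_le_cycres e : e \notin T -> r e <= res e.
Proof.
move=> eT; rewrite -[res e]/(bform Rm (cyc e) (cyc e)) bform_resE (bigD1 e) //=.
rewrite cycvec_off_tree // eqxx !mulr1 lerDl; apply: sumr_ge0 => e' _.
by rewrite -mulrA -expr2 mulr_ge0 ?sqr_ge0 // ltW.
Qed.

Lemma bform_laplacian x y : bform L x y = bform W (B *m x) (B *m y).
Proof. exact: bform_congr. Qed.

Lemma bform_tree_laplacian x y : bform LT x y = bform W (BT *m x) (BT *m y).
Proof. exact: bform_congr. Qed.

Lemma bform_laplacian_ge0 x : 0 <= bform L x x.
Proof.
by rewrite bform_laplacian bform_diag_ge0 // => e; rewrite ltW // invres_gt0.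
Qed.

Lemma bform_tree_laplacian_ge0 x : 0 <= bform LT x x.
Proof.
by rewrite bform_tree_laplacian bform_diag_ge0 // => e; rewrite ltW // invres_gt0.
Qed.

Lemma tree_flow_energy a b : bform Rm (flow a b) (flow a b) <=
  \sum_(e in tree_path src dst T a b) r e.
Proof.
rewrite bform_resE [leRHS]big_mkcond; apply: ler_sum => e _.
rewrite inE -mulrA -expr2; case: eqP => [->|_] /=; first by rewrite expr0n mulr0.
by rewrite ler_piMr ?tree_flow_sqr_le1 // ltW.
Qed.

(** The drop across [e] is the sum of the drops along the tree path, that is, the pairing in [Rm] of
    the tree flow with [W *m (BT *m x)]; Cauchy-Schwarz does the rest. *)
Lemma potential_drop_le (x : 'cV[R]_n) e : (B *m x) e ord0 ^+ 2 <=
  bform Rm (flow (src e) (dst e)) (flow (src e) (dst e)) * bform LT x x.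
Proof.
have := tree_flowP (src e) (dst e); move: (flow _ _) => f [fT fB].
have -> : (B *m x) e ord0 = bform Rm f (W *m (BT *m x)).
  have -> : bform Rm f (W *m (BT *m x)) = (f^T *m (B *m x)) ord0 ord0.
    rewrite bform_resE mxE; apply: eq_bigr => e' _.
    rewrite invresmx_mulE [f^T _ _]mxE incidence_on_mulE.
    have [_|/fT ->] := boolP (e' \in T); last by rewrite mulr0 !mul0r.
    by rewrite mulrACA mulrA mulfV ?gt_eqF // mul1r.
  have := congr1 trmx fB; rewrite trmx_mul trmxK mulmxA => ->.
  by rewrite linearB /= mulmxBl !trmx_delta -!rowE incidence_mulE !mxE.
apply: le_trans (Cauchy_Schwarz_diag _ _ res_ge0) _.
by rewrite bform_res_invresmx -bform_tree_laplacian.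
Qed.

Lemma stretchT_ge0 : 0 <= stretchT src dst r T.
Proof.
apply: sumr_ge0 => e _; apply: mulr_ge0; first by have := r_gt0 e; rewrite -invr_gt0 => /ltW.
by apply: sumr_ge0 => e' _; exact: ltW.
Qed.

Lemma laplacian_le_stretchT x : bform L x x <= stretchT src dst r T * bform LT x x.
Proof.
rewrite bform_laplacian bform_invresE mulr_suml; apply: ler_sum => e _.
rewrite -mulrA -expr2 /stretch -[Rinv _]/((r e)^-1) -mulrA ler_pM2l ?invr_gt0 //.
apply: le_trans (potential_drop_le x e) _.
by apply: ler_wpM2r; [exact: bform_tree_laplacian_ge0|exact: tree_flow_energy].
Qed.

(** * Pseudoinverses of the two Laplacians *)

Local Notation LTp := (pinv LT).
Local Notation Lp := (pinv L).

Lemma laplacian_sym : L^T = L.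
Proof. by rewrite /laplacian !trmx_mul trmxK tr_diag_mx mulmxA. Qed.

Lemma tree_laplacian_sym : LT^T = LT.
Proof. by rewrite /tree_laplacian !trmx_mul trmxK tr_diag_mx mulmxA. Qed.

Lemma incidence_on_tr_incidence : BT^T *m W *m B = LT.
Proof.
apply/matrixP => i j; rewrite !mxE; apply: eq_bigr => e _.
by rewrite mul_mx_diag !mxE; case: (e \in T); rewrite // !mul0r.
Qed.

Lemma incidence_tr_incidence_on : B^T *m W *m BT = LT.
Proof.
rewrite -tree_laplacian_sym -incidence_on_tr_incidence !trmx_mul trmxK tr_diag_mx.
by rewrite mulmxA.
Qed.

(** The stretch bound makes the form of [L] vanish on the kernel of [LT]. Since the weights are
    positive, a vanishing form forces [B *m x = 0], which also gives the converse. *)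
Lemma tree_laplacian_ker (x : 'cV[R]_n) : LT *m x = 0 <-> L *m x = 0.
Proof.
have kerL : bform L x x = 0 -> B *m x = 0.
  by rewrite bform_laplacian; apply: bform_diag_eq0; exact: invres_gt0.
split => h.
  rewrite -mulmxA kerL ?mulmx0 //; apply/le_anti/andP; split.
    apply: le_trans (laplacian_le_stretchT x) _.
    by rewrite {1}/bform -mulmxA h mulmx0 mxE mulr0.
  exact: bform_laplacian_ge0.
rewrite -incidence_on_tr_incidence -mulmxA kerL ?mulmx0 //.
by rewrite /bform -mulmxA h mulmx0 mxE.
Qed.

Lemma tree_pinv_proj : LTp *m LT = Lp *m L.
Proof.
by apply: pinv_proj_eq tree_laplacian_ker;
  [exact: tree_laplacian_sym|exact: laplacian_sym].
Qed.

Lemma tree_pinv_projC : LT *m LTp = L *m Lp.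
Proof.
rewrite (pinv_comm tree_laplacian_sym) (pinv_comm laplacian_sym).
exact: tree_pinv_proj.
Qed.

Lemma bform_pinv_laplacian x : bform Lp x x = bform L (Lp *m x) (Lp *m x).
Proof.
by rewrite -bform_congr (pinv_sym laplacian_sym); have [_ -> _ _] := pinvP L.
Qed.

Lemma bform_pinv_tree_laplacian x : bform LTp x x = bform LT (LTp *m x) (LTp *m x).
Proof.
by rewrite -bform_congr (pinv_sym tree_laplacian_sym); have [_ -> _ _] := pinvP LT.
Qed.

Lemma pinv_laplacian_absorb : Lp *m LT *m LTp = Lp.
Proof. by rewrite -mulmxA tree_pinv_projC mulmxA; have [_ -> _ _] := pinvP L. Qed.

(** * The initial error and its energy *)

Definition initial_error : 'M[R]_(m, n) := W *m BT *m LTp - W *m B *m Lp.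

Lemma incidence_tr_initial_error : B^T *m initial_error = 0.
Proof.
rewrite mulmxBr !mulmxA incidence_tr_incidence_on -/(laplacian src dst r).
by rewrite tree_pinv_projC subrr.
Qed.

(** The columns of the error are circulations, so the term with [B *m Lp] drops out. What remains is
    [(LTp *m LT - Lp *m LT) *m LTp], simplified by the equality of the two projections. *)
Lemma initial_error_energy : initial_error^T *m Rm *m initial_error = LTp - Lp.
Proof.
have RD : Rm *m initial_error = BT *m LTp - B *m Lp.
  by rewrite mulmxBr !mulmxA invresmxK !mul1mx.
have EB : initial_error^T *m B = 0.
  by apply: trmx_inj; rewrite trmx_mul trmxK incidence_tr_initial_error trmx0.
have EBT : initial_error^T *m BT = LTp *m LT - Lp *m LT.
  have h1 : BT^T *m (W *m BT) = LT by rewrite mulmxA.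
  have h2 : B^T *m (W *m BT) = LT by rewrite mulmxA incidence_tr_incidence_on.
  rewrite linearB /= !trmx_mul tr_diag_mx (pinv_sym tree_laplacian_sym).
  by rewrite (pinv_sym laplacian_sym) mulmxBl -!mulmxA h1 h2.
rewrite -mulmxA RD mulmxBr !mulmxA EB mul0mx subr0 EBT mulmxBl.
by rewrite pinv_laplacian_absorb; have [_ -> _ _] := pinvP LT.
Qed.

Lemma initial_error_proj : initial_error *m (LT *m LTp) = initial_error.
Proof.
have h1 : LTp *m (LT *m LTp) = LTp by rewrite mulmxA; have [_ -> _ _] := pinvP LT.
have h2 : Lp *m (LT *m LTp) = Lp by rewrite mulmxA pinv_laplacian_absorb.
by rewrite /initial_error mulmxBl -(mulmxA _ LTp (LT *m LTp)) h1 -(mulmxA _ Lp (LT *m LTp)) h2.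
Qed.

(* [tr (L_T G^T R G)], written as a sum so that no square root of [L_T] is needed. *)
Definition tree_energy (G : 'M[R]_(m, n)) : R :=
  \sum_e (r e)^-1 * bform Rm (col e (G *m BT^T)) (col e (G *m BT^T)).

Lemma tree_energy_initial_error : tree_energy initial_error <= n%:R.
Proof.
apply: le_trans (trace_pinv_mul LT).
rewrite mxtrace_mulC -{1}incidence_on_tr_incidence.
have -> : \tr (BT^T *m W *m B *m LTp) = \sum_e (r e)^-1 * bform LTp (col e BT^T) (col e BT^T).
  rewrite incidence_on_tr_incidence; move: LTp => P.
  rewrite /tree_laplacian -!mulmxA mxtrace_mulC -!mulmxA.
  rewrite /mxtrace; apply: eq_bigr => e _; rewrite invresmx_mulE; congr (_ * _).
  rewrite !colE -bform_congr trmxK /bform trmx_delta -rowE -colE [RHS]mxE [RHS]mxE.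
  by rewrite mulmxA.
apply: ler_sum => e _; rewrite ler_pM2l ?invr_gt0 //.
(* Discarding the nonnegative form of [Lp] leaves the summand of the trace. *)
rewrite colE -mulmxA -colE -bform_congr initial_error_energy.
rewrite {1}/bform mulmxBr mulmxBl mxE [X in _ + X]mxE gerBl.
by rewrite -[X in 0 <= X]/(bform Lp _ _) bform_pinv_laplacian bform_laplacian_ge0.
Qed.

(** The hypothesis lets [G *m x] be written as [M *m (W *m b)], where [b] carries the energy of
    [LTp *m x]; Cauchy-Schwarz in each row of [M] then produces its weighted Frobenius norm, which
    is [tree_energy G]. *)
Lemma tree_energy_loewner (G : 'M[R]_(m, n)) (x : 'cV[R]_n) :
  G *m (LT *m LTp) = G ->
  bform (G^T *m Rm *m G) x x <= tree_energy G * bform LTp x x.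
Proof.
move=> GP; rewrite bform_congr bform_pinv_tree_laplacian bform_tree_laplacian.
set b := BT *m _; set M := G *m BT^T.
have -> : G *m x = M *m (W *m b).
  by rewrite -{1}GP /M /b /tree_laplacian !mulmxA.
have -> : tree_energy G = \sum_i r i * \sum_e (r e)^-1 * M i e ^+ 2.
  under [RHS]eq_bigr => i _ do rewrite mulr_sumr.
  rewrite exchange_big; apply: eq_bigr => e _; rewrite -/M bform_resE mulr_sumr.
  by apply: eq_bigr => i _; rewrite !mxE; ring.
rewrite bform_resE bform_invresE mulr_suml; apply: ler_sum => i _.
rewrite -!mulrA ler_pM2l // -expr2 mxE.
under eq_bigr => e _ do rewrite invresmx_mulE mulrCA mulrA.
under [X in _ * X]eq_bigr => e _ do rewrite -mulrA -expr2.
by apply: Cauchy_Schwarz_sum => e; rewrite invr_ge0 ltW.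
Qed.

(** * One random projection *)

(** Pythagoras: [projmx] is the orthogonal projection along [cyc e] for the inner product of
    [Rm]. *)
Lemma bform_projmx e (g : 'cV[R]_m) : e \notin T ->
  bform Rm (projmx src dst r T e *m g) (projmx src dst r T e *m g) =
  bform Rm g g - bform Rm (cyc e) g ^+ 2 / res e.
Proof.
move=> eT; have res0 : res e != 0.
  by rewrite gt_eqF // (lt_le_trans (r_gt0 e)) ?res_le_cycres.
set a := bform Rm (cyc e) g.
have -> : projmx src dst r T e *m g = g - (a / res e) *: cyc e.
  rewrite /projmx mulmxBl mul1mx; congr (_ - _).
  rewrite -scalemxAl -!mulmxA [X in cyc e *m X](_ : _ = a%:M).
    by rewrite mul_mx_scalar scalerA mulrC.
  by rewrite mulmxA [LHS]mx11_scalar.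
have -> : forall t, bform Rm (g - t *: cyc e) (g - t *: cyc e) =
    bform Rm g g - 2 * t * a + t ^+ 2 * res e.
  move=> t; rewrite /a -[res e]/(bform Rm (cyc e) (cyc e)) !bform_resE !mulr_sumr.
  rewrite -sumrB -big_split; apply: eq_bigr => i _ /=.
  by rewrite !mxE; ring.
by field.
Qed.

Hypothesis off_tree : exists e, e \notin T.
Local Notation tau := (tau src dst r T).
Local Notation q := (sprob src dst r T).

(** Each summand is at least 1 and some edge is off the tree. This keeps the contraction factor
    [1 - tau^-1] nonnegative. *)
Lemma tau_ge1 : 1 <= tau.
Proof.
have [e eT] := off_tree; rewrite /Defs.tau (bigD1 e) //=.
have res_div e' : e' \notin T -> 1 <= Rdiv (res e') (r e').
  by move=> eT'; rewrite RdivE ler_pdivlMr // mul1r res_le_cycres.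
apply: le_trans (res_div _ eT) _; rewrite lerDl; apply: sumr_ge0 => e' /andP[eT' _].
exact: le_trans ler01 (res_div _ eT').
Qed.

Lemma sprobE e : e \notin T -> q e = res e / (r e * tau).
Proof. by rewrite /sprob => /negbTE ->. Qed.

Lemma sprob_ge0 e : 0 <= q e.
Proof.
have [eT|eT] := boolP (e \in T); first by rewrite /sprob eT.
rewrite sprobE // divr_ge0 //; first exact: le_trans (ltW (r_gt0 e)) (res_le_cycres eT).
by rewrite mulr_ge0 ?ltW // (lt_le_trans ltr01 tau_ge1).
Qed.

Lemma sum_sprob (f : 'I_m -> R) :
  \sum_e q e * f e = \sum_(e | e \notin T) res e / (r e * tau) * f e.
Proof.
rewrite [RHS]big_mkcond; apply: eq_bigr => e _; rewrite /sprob.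
by case: ifP => _; rewrite ?mul0r.
Qed.

Lemma sum_sprob_eq1 : \sum_e q e = 1.
Proof.
have tau0 : tau != 0 by rewrite gt_eqF // (lt_le_trans ltr01 tau_ge1).
under eq_bigr => e _ do rewrite -[q e]mulr1.
rewrite sum_sprob -[RHS](mulfV tau0) {2}/Defs.tau mulr_suml.
apply: eq_bigr => e _; rewrite RdivE; field.
by rewrite tau0 gt_eqF.
Qed.

Lemma cycle_energy_le (g : 'cV[R]_m) : B^T *m g = 0 ->
  bform Rm g g <= \sum_(e | e \notin T) (r e)^-1 * bform Rm (cyc e) g ^+ 2.
Proof.
move=> Bg; set z := fun e => bform Rm (cyc e) g.
set S := \sum_(e | _) _.
have S0 : 0 <= S.
  by apply: sumr_ge0 => e _; rewrite mulr_ge0 ?sqr_ge0 // invr_ge0 ltW.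
have g0 : 0 <= bform Rm g g by exact: bform_diag_ge0 res_ge0.
(* Expanding one copy of [g] in fundamental cycles; [r e] is inserted as a weight so that
   Cauchy-Schwarz returns a part of [bform Rm g g] as one factor and [S] as the other. *)
have gE : bform Rm g g = \sum_e r e * (if e \in T then 0 else g e ord0) *
    (if e \in T then 0 else z e / r e).
  rewrite {1}(cycle_space_decomposition Bg) /bform linear_sum /= !mulmx_suml summxE.
  rewrite big_mkcond; apply: eq_bigr => e _; case: (e \in T) => /=.
    by rewrite mulr0.
  rewrite linearZ /= -!scalemxAl mxE -[X in _ * X]/(z e); field.
  by rewrite gt_eqF.
apply: le_of_sqr_le_mul => //; rewrite {1}gE [S * _]mulrC.
apply: le_trans (Cauchy_Schwarz_sum _ _ (fun e => ltW (r_gt0 e))) _.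
apply: ler_pM.
- by apply: sumr_ge0 => e _; rewrite mulr_ge0 ?sqr_ge0 // ltW.
- by apply: sumr_ge0 => e _; rewrite mulr_ge0 ?sqr_ge0 // ltW.
- rewrite bform_resE; apply: ler_sum => e _; rewrite -mulrA -expr2 ler_pM2l //.
  by case: ifP => _ //; rewrite expr0n sqr_ge0.
- rewrite /S [leRHS]big_mkcond; apply: ler_sum => e _; case: ifP => _ /=.
    by rewrite expr0n mulr0.
  rewrite (_ : r e * _ = (r e)^-1 * z e ^+ 2) //; field.
  by rewrite gt_eqF.
Qed.

(** The sampling weight cancels the [res e] in the energy loss, leaving exactly [tau^-1] times the
    sum that dominates [bform Rm g g]. *)
Lemma expected_projection_energy (g : 'cV[R]_m) : B^T *m g = 0 ->
  \sum_e q e * bform Rm (projmx src dst r T e *m g) (projmx src dst r T e *m g) <=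
  (1 - tau^-1) * bform Rm g g.
Proof.
move=> Bg; have tau_gt0 : 0 < tau by exact: lt_le_trans ltr01 tau_ge1.
have -> : \sum_e q e * bform Rm (projmx src dst r T e *m g) (projmx src dst r T e *m g)
  = \sum_e q e * bform Rm g g -
    tau^-1 * \sum_(e | e \notin T) (r e)^-1 * bform Rm (cyc e) g ^+ 2.
  rewrite !sum_sprob mulr_sumr -sumrB; apply: eq_bigr => e eT.
  rewrite bform_projmx //; field; rewrite !gt_eqF //.
  by rewrite (lt_le_trans (r_gt0 e)) ?res_le_cycres.
rewrite -mulr_suml sum_sprob_eq1 mulrBl lerD2l lerN2 ler_pM2l ?invr_gt0 //.
exact: cycle_energy_le.
Qed.

(** The columns of [G *m BT^T] are circulations, so the bound for a single vector applies to each of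
    them. *)
Lemma expected_tree_energy (G : 'M[R]_(m, n)) : B^T *m G = 0 ->
  \sum_e q e * tree_energy (projmx src dst r T e *m G) <= (1 - tau^-1) * tree_energy G.
Proof.
move=> BG; rewrite /tree_energy mulr_sumr.
under eq_bigr => e _ do rewrite mulr_sumr.
rewrite exchange_big; apply: ler_sum => e _ /=.
under eq_bigr => e' _ do rewrite mulrCA -mulmxA colE -mulmxA -colE.
rewrite -mulr_sumr mulrCA ler_pM2l ?invr_gt0 //.
by apply: expected_projection_energy; rewrite colE !mulmxA BG !mul0mx.
Qed.

Lemma incidence_tr_projmx e (G : 'M[R]_(m, n)) :
  B^T *m G = 0 -> B^T *m (projmx src dst r T e *m G) = 0.
Proof.
move=> BG; rewrite /projmx mulmxBl mul1mx mulmxBr BG -scalemxAl -scalemxAr !mulmxA.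
by rewrite incidence_tr_cycvec !mul0mx scaler0 subrr.
Qed.

(** * Deterministic comparisons and the error after all steps *)

(** Inverts the stretch bound: the left side is the pairing in [L] of [Lp *m x] with [LTp *m x], so
    Cauchy-Schwarz followed by [laplacian_le_stretchT] bounds its square, and one factor cancels. *)
Lemma pinv_tree_laplacian_le_stretchT x :
  bform LTp x x <= stretchT src dst r T * bform Lp x x.
Proof.
have a0 : 0 <= bform LTp x x.
  by rewrite bform_pinv_tree_laplacian bform_tree_laplacian_ge0.
have b0 : 0 <= bform Lp x x by rewrite bform_pinv_laplacian bform_laplacian_ge0.
apply: le_of_sqr_le_mul => //; first by rewrite mulr_ge0 ?stretchT_ge0.
have {1}-> : bform LTp x x = bform L (Lp *m x) (LTp *m x).
  rewrite /bform trmx_mul (pinv_sym laplacian_sym) -(mulmxA _ _ L) -tree_pinv_proj.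
  rewrite -(mulmxA x^T _ (LTp *m x)) (mulmxA (LTp *m LT)); have [_ -> _ _] := pinvP LT.
  by rewrite mulmxA.
rewrite bform_laplacian.
apply: le_trans (Cauchy_Schwarz_diag _ _ (fun e => ltW (invres_gt0 e))) _.
rewrite -/(invresmx r) -!bform_laplacian -bform_pinv_laplacian [X in _ <= X * _]mulrC -mulrA.
by rewrite ler_wpM2l // [in leRHS]bform_pinv_tree_laplacian laplacian_le_stretchT.
Qed.

(* Holds because [R^{-1/2} B_T L_T^+ B_T^T R^{-1/2}] is an orthogonal projection. *)
Lemma bform_pinv_tree_laplacian_le (y : 'cV[R]_m) :
  bform LTp (BT^T *m y) (BT^T *m y) <= bform Rm y y.
Proof.
set z := LTp *m (BT^T *m y).
have qE : bform LTp (BT^T *m y) (BT^T *m y) = bform W (BT *m z) (BT *m z).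
  by rewrite bform_pinv_tree_laplacian bform_tree_laplacian.
have a0 : 0 <= bform LTp (BT^T *m y) (BT^T *m y).
  by rewrite bform_pinv_tree_laplacian bform_tree_laplacian_ge0.
apply: le_of_sqr_le_mul => //; first exact: bform_diag_ge0 res_ge0.
rewrite [in leRHS]qE -bform_res_invresmx.
have -> : bform LTp (BT^T *m y) (BT^T *m y) = bform Rm y (W *m (BT *m z)).
  by rewrite /bform -(mulmxA y^T) (mulmxA Rm) invresmxK mul1mx trmx_mul trmxK !mulmxA.
exact: Cauchy_Schwarz_diag res_ge0.
Qed.

(** [Rm] cancels [W], and the circulation [cyc e] is orthogonal to every potential difference. *)
Lemma projmx_optimal_flow e :
  projmx src dst r T e *m (W *m B *m Lp) = W *m B *m Lp.
Proof.
have cB : (cyc e)^T *m B = 0.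
  by apply: trmx_inj; rewrite trmx_mul trmxK incidence_tr_cycvec trmx0.
rewrite /projmx mulmxBl mul1mx -scalemxAl -(mulmxA _ Rm) !(mulmxA Rm) invresmxK.
by rewrite mul1mx -(mulmxA (cyc e)) (mulmxA _ B) cB mul0mx mulmx0 scaler0 subr0.
Qed.

Local Notation step := (fun (G : 'M[R]_(m, _)) e => projmx src dst r T e *m G).

Lemma foldl_projmx k l (A : 'M[R]_(m, k)) (M : 'M[R]_(k, l)) s :
  foldl step (A *m M) s = foldl step A s *m M.
Proof. by elim: s A => //= e s IH A; rewrite mulmxA IH. Qed.

Lemma foldl_projmx_optimal_flow s : foldl step (W *m B *m Lp) s = W *m B *m Lp.
Proof. by elim: s => //= e s IH; rewrite projmx_optimal_flow. Qed.

(** The steps are linear and fix the optimal flow, so the two terms of the initial error pass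
    through the product separately. *)
Lemma FK_error s :
  FK src dst r T s - W *m B *m Lp = foldl step initial_error s.
Proof.
rewrite -[initial_error]mul1mx foldl_projmx mulmxBr.
rewrite -[X in _ = _ - X]foldl_projmx mul1mx foldl_projmx_optimal_flow.
by rewrite /FK /projprod !mulmxA.
Qed.

Lemma FK_error_proj s : foldl step initial_error s *m (LT *m LTp) =
  foldl step initial_error s.
Proof. by rewrite -foldl_projmx initial_error_proj. Qed.

(** Applying [LTp *m BT^T] to the optimal flow gives [LTp *m LT *m Lp], which is [Lp] by the
    equality of the projections. *)
Lemma VK_error s : VK src dst r T s - Lp =
  LTp *m (BT^T *m (FK src dst r T s - W *m B *m Lp)).
Proof.
rewrite /VK !mulmxBr !mulmxA; congr (_ - _).
rewrite -!(mulmxA LTp) incidence_on_tr_incidence.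
by rewrite (mulmxA LTp) tree_pinv_proj; have [_ -> _ _] := pinvP L.
Qed.

Lemma bform_scale k (a : R) (A : 'M[R]_k) x y : bform (a *: A) x y = a * bform A x y.
Proof. by rewrite /bform -scalemxAr -scalemxAl mxE. Qed.

Lemma solver_error_le (s : seq 'I_m) (eps : R) :
  0 <= eps ->
  let D := FK src dst r T s - W *m B *m Lp in
  let Z := VK src dst r T s - Lp in
  let st := stretchT src dst r T in
  tree_energy D <= eps ->
  [/\ loewner_le (D^T *m Rm *m D) (eps *: LTp),
      loewner_le (eps *: LTp) ((eps * st) *: Lp) &
      loewner_le (Z^T *m L *m Z) ((eps * st ^+ 2) *: Lp)].
Proof.
move=> eps0 D Z st Deps.
have H1 x : bform (D^T *m Rm *m D) x x <= eps * bform LTp x x.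
  apply: le_trans (tree_energy_loewner _ _) _; first by rewrite /D FK_error FK_error_proj.
  by rewrite ler_wpM2r // bform_pinv_tree_laplacian bform_tree_laplacian_ge0.
have H2 x : eps * bform LTp x x <= eps * st * bform Lp x x.
  by rewrite -mulrA ler_wpM2l ?pinv_tree_laplacian_le_stretchT.
split=> x; apply/RleP.
- by rewrite -[leRHS]/(bform (_ *: _) x x) bform_scale; exact: H1.
- by rewrite -[leRHS]/(bform (_ *: _) x x) -[leLHS]/(bform (_ *: _) x x) !bform_scale.
rewrite -[leRHS]/(bform (_ *: _) x x) -[leLHS]/(bform _ x x) bform_scale bform_congr.
(* One factor [st] pays for passing from [L] to [LT], the other for passing from [LTp] to [Lp]. *)
have -> : eps * st ^+ 2 * bform Lp x x = st * (eps * st * bform Lp x x) by ring.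
apply: le_trans (laplacian_le_stretchT _) _; rewrite ler_wpM2l ?stretchT_ge0 //.
apply: le_trans (H2 x); apply: le_trans (H1 x); rewrite [leRHS]bform_congr.
have -> : Z *m x = LTp *m (BT^T *m (D *m x)) by rewrite /Z VK_error !mulmxA.
by rewrite -bform_pinv_tree_laplacian bform_pinv_tree_laplacian_le.
Qed.

(** * Expected energy and Markov's inequality *)

(** Induction on the draws: [foldl] applies the head of the tuple first, so the induction hypothesis
    is used for the matrix already projected once, whose columns are still circulations. *)
Lemma expected_tree_energy_iter K (G : 'M[R]_(m, n)) : B^T *m G = 0 ->
  \sum_(s : K.-tuple 'I_m) (\prod_(e <- s) q e) * tree_energy (foldl step G s) <=
  (1 - tau^-1) ^+ K * tree_energy G.
Proof.
have c0 : 0 <= 1 - tau^-1.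
  by rewrite subr_ge0 invf_le1 ?tau_ge1 // (lt_le_trans ltr01 tau_ge1).
elim: K G => [|K IH] G BG.
  by rewrite sum_tuple0 /= big_nil expr0.
rewrite sum_tuple_cons exprSr -mulrA.
apply: le_trans (ler_wpM2l (exprn_ge0 K c0) (expected_tree_energy BG)).
rewrite mulr_sumr; apply: ler_sum => e _.
under eq_bigr => s _ do rewrite /= big_cons -mulrA.
rewrite -mulr_sumr mulrCA ler_wpM2l ?sprob_ge0 //.
exact/IH/incidence_tr_projmx.
Qed.

(** Pointwise, [1 - f s / a] is at most the indicator of the event; average over the tuples, whose
    weights sum to 1. *)
Lemma Markov_prob_iid K (ev : K.-tuple 'I_m -> Prop) (f : K.-tuple 'I_m -> R) (a : R) :
  0 < a -> (forall s, 0 <= f s) -> (forall s, f s <= a -> ev s) ->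
  1 - (\sum_(s : K.-tuple 'I_m) (\prod_(e <- s) q e) * f s) / a <= prob_iid q ev.
Proof.
move=> a0 f0 fev; rewrite /prob_iid.
have total : \sum_(s : K.-tuple 'I_m) \prod_(e <- s) q e = 1.
  by rewrite sum_prod_tuple sum_sprob_eq1 expr1n.
rewrite -[X in X - _]total mulr_suml -sumrB.
apply: ler_sum => s _.
set w := \prod_(e <- s) q e.
suff : w * (1 - f s / a) <= w * indic (ev s) by rewrite mulrBr mulr1 mulrA.
apply: ler_wpM2l.
  by apply: prodr_ge0 => e _; exact: sprob_ge0.
rewrite /indic; case: excluded_middle_informative => /= [_|nev].
  by rewrite -[leRHS]/(1 : R) gerBl divr_ge0 // ltW.
rewrite -[leRHS]/(0 : R) subr_le0 ler_pdivlMr // mul1r.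
by have [/fev//|/ltW] := lerP (f s) a.
Qed.

Lemma tree_energy_ge0 (G : 'M[R]_(m, n)) : 0 <= tree_energy G.
Proof.
apply: sumr_ge0 => e _; apply: mulr_ge0; first by rewrite invr_ge0 ltW.
exact: bform_diag_ge0 res_ge0.
Qed.

Lemma solver_success_prob K (eps p : R) : 0 < eps -> 0 < p ->
  (1 - tau^-1) ^+ K * n%:R <= eps * p ->
  1 - p <= prob_iid q (fun s : K.-tuple 'I_m =>
    tree_energy (FK src dst r T s - W *m B *m Lp) <= eps).
Proof.
move=> eps0 p0 hK.
have := @Markov_prob_iid K _ (fun s => tree_energy (FK src dst r T s - W *m B *m Lp)) _ eps0
  (fun s => tree_energy_ge0 _) (fun s => id).
apply: le_trans; rewrite lerD2l lerN2 ler_pdivrMr // [p * _]mulrC; apply: le_trans hK.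
under eq_bigr => s _ do rewrite FK_error.
apply: le_trans (expected_tree_energy_iter _ incidence_tr_initial_error) _.
apply: ler_wpM2l tree_energy_initial_error; apply: exprn_ge0.
by rewrite subr_ge0 invf_le1 ?tau_ge1 // (lt_le_trans ltr01 tau_ge1).
Qed.

End SpanningTree.

(** * The number of iterations *)

Lemma natr_INR k : k%:R = INR k :> R.
Proof. by elim: k => // k IH; rewrite -natr1 IH S_INR. Qed.

(** [up x] lies strictly above [x]; the special case of [Rceil] is the one where its predecessor
    equals [x]. *)
Lemma Rle_Rceil x : Rle x (IZR (Rceil x)).
Proof.
rewrite /Rceil; case: Req_EM_T => h; last by apply: Rlt_le; case: (archimed x).
by rewrite -Z.sub_1_r minus_IZR h; exact: Rle_refl.
Qed.

(** A negative ceiling is truncated to 0, which only increases the number of steps. *)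
Lemma IZR_le_INR_to_nat z : Rle (IZR z) (INR (Z.to_nat z)).
Proof. by rewrite INR_IZR_INZ; apply: IZR_le; lia. Qed.

Lemma exp_mulrn (x : R) k : exp (x *+ k) = exp x ^+ k.
Proof.
elim: k => [|k IH]; first exact: exp_0.
by rewrite mulrS exprS -IH; exact: exp_plus.
Qed.

(** From [1 + u <= exp u] with [u = - t^-1], the power is at most [exp (- k / t)], hence at most
    [exp (- ln a)], the inverse of [a]. *)
Lemma pow_contraction_le (t a : R) k : 1 <= t -> 0 < a -> Rle (t * ln a) (INR k) ->
  (1 - t^-1) ^+ k * a <= 1.
Proof.
move=> t1 a0 hk; have t0 : 0 < t by exact: lt_le_trans ltr01 t1.
have c0 : 0 <= 1 - t^-1 by rewrite subr_ge0 invf_le1.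
pose u : R := - t^-1.
have cexp : 1 + u <= exp u by apply/RleP; exact: exp_ineq1_le.
have hpow : (1 + u) ^+ k <= exp (u *+ k).
  by rewrite exp_mulrn lerXn2r // nnegrE // (le_trans c0).
have hexp : exp (u *+ k) <= exp (- ln a).
  have : u *+ k <= - ln a.
    by rewrite mulNrn lerN2 -mulr_natl natr_INR ler_pdivlMr // mulrC; apply/RleP.
  by rewrite le_eqVlt => /predU1P[->//|/RltP/exp_increasing h]; apply/RleP; left.
apply: le_trans (ler_wpM2r (ltW a0) (le_trans hpow hexp)) _.
rewrite exp_Ropp exp_ln; last exact/RltP.
by rewrite -[Rinv a]/(a^-1) mulVf // gt_eqF.
Qed.

Lemma sub_prob_iid (m K : nat) (q : 'I_m -> R) (ev ev' : K.-tuple 'I_m -> Prop) :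
  (forall e, 0 <= q e) -> (forall s, ev s -> ev' s) -> prob_iid q ev <= prob_iid q ev'.
Proof.
move=> q0 evv; apply: ler_sum => s _; apply: ler_wpM2l; first exact: prodr_ge0.
rewrite /indic; case: (excluded_middle_informative (ev s)) => /= [h|_].
  by case: excluded_middle_informative => /= [_|[]]; [exact: lexx|exact: evv].
by case: excluded_middle_informative => /= _; [exact: ler01|exact: lexx].
Qed.

Theorem theorem10p3 (n m : nat) (src dst : 'I_m -> 'I_n) (r : 'I_m -> R)
    (T : {set 'I_m}) (eps p : R) :
  (forall e : 'I_m, src e != dst e) ->
  (forall e : 'I_m, Rlt 0 (r e)) ->
  connected_edges src dst [set: 'I_m] ->
  spanning_tree src dst T ->
  (exists e : 'I_m, e \notin T) ->
  Rlt 0 eps -> Rlt 0 p -> Rlt p 1 ->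
  let K := Z.to_nat (Rceil (tau src dst r T * ln (Rdiv (INR n) (eps * p)))) in
  let Lp := pinv (laplacian src dst r) in
  let LTp := pinv (tree_laplacian src dst r T) in
  let st := stretchT src dst r T in
  Rle (1 - p)
    (prob_iid (sprob src dst r T) (fun s : K.-tuple 'I_m =>
       let F := FK src dst r T s in
       let V := VK src dst r T s in
       let D := F - invresmx r *m incidence src dst *m Lp in
       let W := V - Lp in
       [/\ loewner_le (D^T *m resmx r *m D) (eps *: LTp),
           loewner_le (eps *: LTp) ((eps * st) *: Lp) &
           loewner_le (W^T *m laplacian src dst r *m W) ((eps * st ^+ 2) *: Lp)])).
Proof.
move=> sd r0 _ tree off /RltP eps0 /RltP p0 _ K Lp LTp st; apply/RleP.
have r_gt0 e : 0 < r e by apply/RltP.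
have n0 : 0 < n%:R :> R.
  have [e _] := off; rewrite ltr0n; exact: leq_ltn_trans (ltn_ord (src e)).
(* It suffices to bound the probability of the smaller event that the tree energy of the error is at
   most [eps]. *)
apply: le_trans (sub_prob_iid _ _); last first.
- by move=> s; apply: (solver_error_le sd r_gt0 tree (ltW eps0)).
- by move=> e; exact: sprob_ge0.
apply: (solver_success_prob sd r_gt0 tree off eps0 p0).
have ep0 : 0 < eps * p by rewrite mulr_gt0.
(* Brings the goal into the form of [pow_contraction_le] with [a = n / (eps * p)], the argument of
   the logarithm in [K]. *)
rewrite -[leRHS]mul1r -ler_pdivrMr // -mulrA natr_INR.
apply: pow_contraction_le; first exact: tau_ge1.
  by rewrite -natr_INR divr_gt0.
by apply: Rle_trans (Rle_Rceil _) _; exact: IZR_le_INR_to_nat.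
Qed.
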